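(* Let $\tau$ be a substitution on $\mathcal A=\{0,1,\ldots,n-1\}$ satisfying the standing assumptions below, which is prefix permutative and suffix permutative and has $n$ right-infinite fixed points, the $i$-th of which is a $k_i$-branch point. Suppose $\mathcal L_\tau$ has exactly $N$ words of length $2$. Then there exists a substitution $\tau'$ on $\mathcal A'=\{0,1,\ldots,N-1\}$ such that $\tau'$ is suffix permutative, has $n$ fixed points, the $i$-th of which is a $k_i$-branch point, $(X_\tau,\sigma)$ is topologically conjugate to $(X_{\tau'},\sigma)$, and the Vershik map $V_{\tau'}$ on $\mathcal B_{\tau'}$ extends continuously so that $(X_{\tau'},\sigma)$ is topologically conjugate to $(X_{\mathcal B_{\tau'}},V_{\tau'})$.
   Context: Substitutions are extended to words and one-sided sequences by concatenation; $\sigma$ is the left shift; for a substitution $\theta$, $X_\theta\subset\mathcal A^{\mathbb N}$ is the closure of the shift orbit of a (generating) fixed point, $\mathcal L_\theta$ the set of subwords of the words $\theta^m(a)$. $\tau$ is prefix (suffix) permutative if the map sending each letter $a$ to the first (last) letter of $\tau(a)$ is a permutation of $\mathcal A$. A $k$-branch point of $X_\theta$ is a point with exactly $k$ preimages under $\sigma:X_\theta\to X_\theta$, $k\ge2$. Standing assumptions: $\tau$ primitive, $X_\tau$ infinite, $\tau$ unilaterally recognizable, all powers injective on letters. $\mathcal B_{\tau'}$ is the stationary ordered Bratteli diagram of $\tau'$: $V_0=\{v_0\}$, $V_n=\mathcal A'$ for $n\ge1$, one edge from $v_0$ to each vertex of $V_1$, and for $n\ge2$ the edges into $a\in V_n$,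 in increasing order, have as sources in $V_{n-1}$ the successive letters of $\tau'(a)$. $X_{\mathcal B_{\tau'}}$ is the space of infinite paths (product topology). For non-maximal $x$, with $k$ least such that $x_k$ is not maximal and $y_k$ its successor, $V_{\tau'}(x)=(z_1,\ldots,z_{k-1},y_k,x_{k+1},\ldots)$, $z_1\cdots z_{k-1}$ the minimal path from $v_0$ to $s(y_k)$. *)

(* Defs.v *)
From Stdlib Require List.
From mathcomp Require Import all_boot.
Set Implicit Arguments. Unset Strict Implicit. Unset Printing Implicit Defensive.

Definition subst (n : nat) := 'I_n -> seq 'I_n.

Definition nonerasing n (t : subst n) : Prop := forall a, t a != [::].

Definition subst_word n (t : subst n) (w : seq 'I_n) : seq 'I_n :=
  flatten [seq t a | a <- w].

Definition pow_subst n (t : subst n) (m : nat) : subst n :=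
  fun a => iter m (subst_word t) [:: a].

(* Extension to one-sided sequences by concatenation:
   t(x) = t(x_0) t(x_1) ...  (the i-th letter lies within t(x_0..x_i) for
   a non-erasing t). *)
Definition subst_seq n (t : subst n) (x : nat -> 'I_n) : nat -> 'I_n :=
  fun i => nth (x 0) (flatten [seq t (x j) | j <- iota 0 i.+1]) i.

Definition shift (T : Type) (x : nat -> T) : nat -> T := fun i => x i.+1.
Definition shiftn (T : Type) (k : nat) (x : nat -> T) : nat -> T :=
  fun i => x (i + k).

(* Agreement on the first k coordinates (cylinders of the product topology
   of a countable product of discrete spaces). *)
Definition agree (T : Type) (k : nat) (x y : nat -> T) : Prop :=
  forall i, i < k -> x i = y i.

Definition cont_on (S T : Type) (X : (nat -> S) -> Prop)
    (f : (nat -> S) -> (nat -> T)) : Prop :=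
  forall x, X x -> forall m, exists k, forall y, X y -> agree k x y ->
    agree m (f x) (f y).

Definition top_conj (S T : Type) (X : (nat -> S) -> Prop)
    (F : (nat -> S) -> (nat -> S)) (Y : (nat -> T) -> Prop)
    (G : (nat -> T) -> (nat -> T)) : Prop :=
  exists (phi : (nat -> S) -> (nat -> T)) (psi : (nat -> T) -> (nat -> S)),
    (forall x, X x -> Y (phi x)) /\ (forall y, Y y -> X (psi y)) /\
    (forall x, X x -> psi (phi x) = x) /\ (forall y, Y y -> phi (psi y) = y) /\
    cont_on X phi /\ cont_on Y psi /\
    (forall x, X x -> phi (F x) = G (phi x)).

Definition lang n (t : subst n) (w : seq 'I_n) : Prop :=
  exists m a, infix w (pow_subst t m a).

Definition fixed_point n (t : subst n) (x : nat -> 'I_n) : Prop :=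
  subst_seq t x = x.

(* Generating fixed point: fixed point of a power t^p, p > 0, with
   |t^p(u_0)| >= 2 (so u = lim t^{pm}(u_0)). *)
Definition gen_fixed_point n (t : subst n) (u : nat -> 'I_n) : Prop :=
  exists p, 0 < p /\ fixed_point (pow_subst t p) u /\
            1 < size (pow_subst t p (u 0)).

Definition orbit_closure (T : Type) (u : nat -> T) (x : nat -> T) : Prop :=
  forall k, exists j, agree k (shiftn j u) x.

Definition X_sub n (t : subst n) (x : nat -> 'I_n) : Prop :=
  exists u, gen_fixed_point t u /\ orbit_closure u x.

Definition branch_point (T : Type) (X : (nat -> T) -> Prop) (x : nat -> T)
    (k : nat) : Prop :=
  [/\ 2 <= k, X x &
    exists f : 'I_k -> (nat -> T), injective f /\
      forall y, (X y /\ shift y = x) <-> exists j, f j = y].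

Definition fixed_points_branch n m (t : subst m) (k : 'I_n -> nat) : Prop :=
  exists u : 'I_n -> (nat -> 'I_m),
    [/\ injective u, (forall x, fixed_point t x <-> exists i, u i = x) &
        forall i, branch_point (X_sub t) (u i) (k i)].

Definition primitive n (t : subst n) : Prop :=
  exists m, 0 < m /\ forall a b, b \in pow_subst t m a.

Definition infinite_subshift n (t : subst n) : Prop :=
  ~ exists l : list (nat -> 'I_n), forall x, X_sub t x -> List.In x l.

Definition unil_recognizable n (t : subst n) : Prop :=
  forall x, X_sub t x -> exists kp : nat * (nat -> 'I_n),
    [/\ X_sub t kp.2, kp.1 < size (t (kp.2 0)),
        x = shiftn kp.1 (subst_seq t kp.2) &
        forall k' y', X_sub t y' -> k' < size (t (y' 0)) ->
          x = shiftn k' (subst_seq t y') -> (k', y') = kp].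

Definition powers_injective n (t : subst n) : Prop :=
  forall m, injective (pow_subst t m).

Definition prefix_permutative n (t : subst n) : Prop :=
  exists f : 'I_n -> 'I_n, bijective f /\ forall a, head (f a) (t a) = f a.
Definition suffix_permutative n (t : subst n) : Prop :=
  exists f : 'I_n -> 'I_n, bijective f /\ forall a, last (f a) (t a) = f a.

Definition num_words2 n (t : subst n) (N : nat) : Prop :=
  exists e : 'I_N -> seq 'I_n, injective e /\
    forall w, (lang t w /\ size w = 2) <-> exists j, e j = w.

(* Stationary ordered Bratteli diagram B_t of t on 'I_N.
   A path is p : nat -> 'I_N * nat; p i is the edge of level i+1 (from
   V_i to V_{i+1}), encoded by its range vertex (p i).1 and its position
   (p i).2 among the edges into (p i).1: for i = 0 the unique edge from v0
   (position 0); for i >= 1 the edge with source the (p i).2-th letter of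
   t((p i).1). *)
Definition B_path N (t : subst N) (p : nat -> 'I_N * nat) : Prop :=
  (p 0).2 = 0 /\
  forall i, 0 < i -> (p i).2 < size (t (p i).1) /\
    nth (p i).1 (t (p i).1) (p i).2 = (p i.-1).1.

Definition edge_max N (t : subst N) (p : nat -> 'I_N * nat) (i : nat) : Prop :=
  i = 0 \/ (p i).2.+1 = size (t (p i).1).

Definition B_nonmax N (t : subst N) (p : nat -> 'I_N * nat) : Prop :=
  exists i, ~ edge_max t p i.

Definition min_vertex N (t : subst N) (b : 'I_N) (d : nat) : 'I_N :=
  iter d (fun c => nth c (t c) 0) b.

Definition vershik_at N (t : subst N) (p q : nat -> 'I_N * nat) : Prop :=
  exists k, [/\ forall i, i < k -> edge_max t p i, ~ edge_max t p k &
    let b := nth (p k).1 (t (p k).1) (p k).2.+1 in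
    [/\ forall i, k < i -> q i = p i,
        q k = ((p k).1, (p k).2.+1) &
        forall i, i < k -> q i = (min_vertex t b (k.-1 - i), 0)]].

(* Main.v *)
(* The n fixed points have distinct first letters, so tau(a) begins with a for
   every letter a.  The letters of tau' are the two-letter words ab of the
   language of tau, and tau'(ab) lists the successive two-letter words of
   tau(a)b; its last letter is (last letter of tau(a))b, whence suffix
   permutativity, and X_tau' is the two-block recoding of X_tau.
   Iterating recognizability, x = sigma^k1 tau(x1), x1 = sigma^k2 tau(x2), ...,
   sends x to the path with vertices given by the two-letter prefixes of the
   x_i and edge positions k_i.  This map is continuous by compactness.  It is
   injective with continuous inverse because the word of tau^m(ab) to the right
   of the current position always contains tau^m(b), whose length grows with m;
   this is what recording two letters instead of one buys.  It is onto by
   compactness.  The extension of the Vershik map is the shift transported along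
   it: shifting x adds one to the first non-maximal position k_i and resets the
   earlier ones to 0. *)
From Stdlib Require Import FunctionalExtensionality ClassicalEpsilon.
Require Import Defs.
From mathcomp Require Import all_boot.
Set Implicit Arguments. Unset Strict Implicit. Unset Printing Implicit Defensive.

(** Written as an equation with [mkseq], so that it needs no default letter and rewrites in both
    directions. *)
Definition pref (T : Type) (w : seq T) (x : nat -> T) : Prop :=
  mkseq x (size w) = w.

(** * Substitutions on words and sequences *)

Section Sequences.
Variable T : Type.
Implicit Types (x y : nat -> T) (w : seq T).

Lemma mkseqD x m k : mkseq x (m + k) = mkseq x m ++ mkseq (shiftn m x) k.
Proof.
rewrite /mkseq iotaD map_cat add0n -[m in iota m k]addn0 iotaDl -map_comp.
by congr (_ ++ _); apply: eq_map => i /=; rewrite /shiftn addnC.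
Qed.

Lemma pref_mkseq x m : pref (mkseq x m) x.
Proof. by rewrite /pref size_mkseq. Qed.

Lemma pref_nth w x i d : pref w x -> i < size w -> nth d w i = x i.
Proof. by move=> <-; rewrite size_mkseq => lti; rewrite nth_mkseq. Qed.

Lemma pref_catl w1 w2 x : pref (w1 ++ w2) x -> pref w1 x.
Proof.
rewrite /pref size_cat mkseqD => /(congr1 (take (size w1))).
by rewrite take_size_cat ?size_mkseq // take_size_cat.
Qed.

Lemma agree_mkseq m x y : agree m x y <-> mkseq x m = mkseq y m.
Proof.
split=> [xy | xy i lti].
  by apply/eq_in_map => i; rewrite mem_iota => /andP[_]; apply: xy.
by rewrite -(nth_mkseq (x 0) x lti) xy nth_mkseq.
Qed.

Lemma agree_pref w x y : pref w x -> pref w y -> agree (size w) x y.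
Proof. by move=> wx wy; apply/agree_mkseq; rewrite wx wy. Qed.

Lemma agree_sym m x y : agree m x y -> agree m y x.
Proof. by move=> xy i lti; rewrite xy. Qed.

Lemma agreeW m k x y : m <= k -> agree k x y -> agree m x y.
Proof. by move=> le xy i lti; apply: xy; apply: leq_trans le. Qed.

Lemma agree_shift m x y : agree m.+1 x y -> agree m (shift x) (shift y).
Proof. by move=> xy i lti; apply: xy. Qed.

End Sequences.

Section Substitutions.
Variable n : nat.
Implicit Types (s t : subst n) (x y : nat -> 'I_n) (w : seq 'I_n).

Lemma subst_word_cat t w1 w2 :
  subst_word t (w1 ++ w2) = subst_word t w1 ++ subst_word t w2.
Proof. by rewrite /subst_word map_cat flatten_cat. Qed.

Lemma subst_word_cons t a w : subst_word t (a :: w) = t a ++ subst_word t w.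
Proof. by []. Qed.

Lemma subst_word1 t a : subst_word t [:: a] = t a.
Proof. by rewrite /subst_word /= cats0. Qed.

Lemma pow_subst1 t : pow_subst t 1 = t.
Proof. by apply: functional_extensionality => a; apply: subst_word1. Qed.

Lemma subst_word_comp s t w :
  subst_word (fun a => subst_word t (s a)) w = subst_word t (subst_word s w).
Proof.
elim: w => // a w IH; rewrite !subst_word_cons IH.
by rewrite subst_word_cat.
Qed.

Lemma size_subst_word c t w : (forall a, c <= size (t a)) ->
  c * size w <= size (subst_word t w).
Proof.
move=> ct; elim: w => [|a w IH]; first by rewrite muln0.
by rewrite subst_word_cons size_cat mulnS leq_add.
Qed.

Lemma nonerasing_size t : nonerasing t <-> forall a, 1 <= size (t a).
Proof.
by split=> h a; move: (h a); case: (t a).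
Qed.

Lemma size_subst_word1 t w : nonerasing t -> size w <= size (subst_word t w).
Proof.
by move=> /nonerasing_size /size_subst_word h; rewrite -[size w]mul1n.
Qed.

Lemma pow_substS t m a : pow_subst t m.+1 a = subst_word t (pow_subst t m a).
Proof. by []. Qed.

Lemma subst_word_pow t m w : subst_word (pow_subst t m) w = iter m (subst_word t) w.
Proof.
elim: m w => [|m IH] w /=.
  by rewrite /subst_word /= flatten_map1 map_id.
by rewrite -IH -subst_word_comp.
Qed.

Lemma pow_substD t m p a :
  pow_subst t (m + p) a = subst_word (pow_subst t m) (pow_subst t p a).
Proof. by rewrite subst_word_pow /pow_subst iterD. Qed.

Lemma pow_substM t p m a : pow_subst (pow_subst t p) m a = pow_subst t (m * p) a.
Proof.
elim: m => // m IH; rewrite pow_substS IH mulSn.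
by rewrite -pow_substD.
Qed.

Lemma nonerasing_pow t m : nonerasing t -> nonerasing (pow_subst t m).
Proof.
move=> tne; apply/nonerasing_size => a; elim: m => // m IH.
by rewrite pow_substS (leq_trans IH) // size_subst_word1.
Qed.

Lemma size_pow_subst t m a : (forall b, 2 <= size (t b)) ->
  m < size (pow_subst t m a).
Proof.
move=> t2; elim: m => // m IH; rewrite pow_substS.
apply: leq_trans (size_subst_word _ t2).
rewrite mul2n -addnn (leq_ltn_trans IH) // -[ltnLHS]addn0 ltn_add2l.
exact: leq_ltn_trans IH.
Qed.

Variable t : subst n.
Hypothesis tne : nonerasing t.

Lemma subst_seqE x i :
  subst_seq t x i = nth (x 0) (subst_word t (mkseq x i.+1)) i.
Proof. by rewrite /subst_word -map_comp. Qed.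

(** The images of two prefixes of [x] are both prefixes of the image of a longer one. This frees the
    i-th letter from the prefix of length i+1 built into [subst_seq]. *)
Lemma subst_seq_nth x m i d : i < size (subst_word t (mkseq x m)) ->
  subst_seq t x i = nth d (subst_word t (mkseq x m)) i.
Proof.
move=> lti; have lti' : i < size (subst_word t (mkseq x i.+1)).
  by apply: leq_trans (size_subst_word1 _ tne); rewrite size_mkseq.
have h w1 w2 : i < size w1 -> nth d (w1 ++ w2) i = nth d w1 i.
  by rewrite nth_cat => ->.
rewrite -(h _ (subst_word t (mkseq (shiftn m x) i.+1)) lti) -subst_word_cat -mkseqD.
rewrite addnC mkseqD subst_word_cat h // subst_seqE.
exact: set_nth_default.
Qed.

Lemma pref_subst w x : pref w x -> pref (subst_word t w) (subst_seq t x).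
Proof.
move=> wx; apply: (@eq_from_nth _ (x 0)); rewrite size_mkseq // => i lti.
by rewrite nth_mkseq // -{1}wx; apply: subst_seq_nth; rewrite wx.
Qed.

Lemma agree_subst m x y : agree m x y -> agree m (subst_seq t x) (subst_seq t y).
Proof.
move=> /agree_mkseq xy.
apply: agreeW (agree_pref (pref_subst (pref_mkseq x m)) _).
  by rewrite -[leqLHS](size_mkseq x) size_subst_word1.
by rewrite xy; apply/pref_subst/pref_mkseq.
Qed.

Lemma shiftn_subst_seq x m :
  shiftn (size (subst_word t (mkseq x m))) (subst_seq t x) =
  subst_seq t (shiftn m x).
Proof.
apply: functional_extensionality => i; rewrite {1}/shiftn.
have lti : i < size (subst_word t (mkseq (shiftn m x) i.+1)).
  by apply: leq_trans (size_subst_word1 _ tne); rewrite size_mkseq.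
rewrite (@subst_seq_nth x (m + i.+1) _ (x 0)) mkseqD subst_word_cat; last first.
  by rewrite size_cat addnC ltn_add2l.
by rewrite nth_cat ltnNge leq_addl /= addnK -subst_seq_nth.
Qed.

Lemma subst_seq_shift x :
  subst_seq t (shift x) = shiftn (size (t (x 0))) (subst_seq t x).
Proof.
rewrite -[t (x 0)]subst_word1 (shiftn_subst_seq x 1); congr subst_seq.
by apply: functional_extensionality => i; rewrite /shiftn addn1.
Qed.

Lemma subst_seq_pos x i : exists m j,
  j < size (t (x m)) /\ i = j + size (subst_word t (mkseq x m)).
Proof.
elim: i => [|i [m [j [ltj ->]]]].
  by exists 0, 0; split; first exact: (nonerasing_size _).1.
have [ltj'|gej] := ltnP j.+1 (size (t (x m))).
  by exists m, j.+1.
exists m.+1, 0; split; first exact: (nonerasing_size _).1.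
rewrite -[m.+1]addn1 mkseqD subst_word_cat size_cat /= subst_word1.
rewrite /shiftn add0n.
have -> : size (t (x m)) = j.+1 by apply/eqP; rewrite eqn_leq gej ltj.
by rewrite addnS addnC.
Qed.

Lemma fixed_head x : fixed_point t x -> forall d, head d (t (x 0)) = x 0.
Proof.
move=> fx d; rewrite -{2}fx (@subst_seq_nth x 1 0 d) /= subst_word1 ?nth0 //.
exact: (nonerasing_size _).1.
Qed.

Lemma size_iter_head a m d : head d (t a) = a -> 1 < size (t a) ->
  m < size (pow_subst t m a).
Proof.
move=> hd sz.
(* Each iteration keeps the leading [a], adds the nonempty rest of [t a], and does not shorten
   [w]. *)
suff [w [-> //]] : exists w, pow_subst t m a = a :: w /\ m <= size w.
elim: m => [|m [w [IHm szw]]]; first by exists [::].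
rewrite pow_substS IHm subst_word_cons.
case E: (t a) hd sz => [|b w'] //= eb; rewrite ltnS => w'0.
exists (w' ++ subst_word t w).
rewrite eb; split=> //.
rewrite size_cat -addn1 addnC leq_add // (leq_trans szw) //.
exact: size_subst_word1.
Qed.

Lemma pref_pow m a x : fixed_point t x -> x 0 = a -> pref (pow_subst t m a) x.
Proof.
move=> fx <-; elim: m => [|m IH]; first by rewrite /pref.
by rewrite pow_substS -{2}fx; apply: pref_subst.
Qed.

(** Both points have all the words t^m(a) as prefixes, a being their common first letter, and these
    lengths are unbounded. *)
Lemma fixed_point_uniq x y : fixed_point t x -> fixed_point t y ->
  x 0 = y 0 -> 1 < size (t (x 0)) -> x = y.
Proof.
move=> fx fy xy sz; apply: functional_extensionality => i.
have lt_i := size_iter_head i (fixed_head fx (x 0)) sz.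
exact: (agree_pref (pref_pow i fx erefl) (pref_pow i fy (esym xy))).
Qed.

End Substitutions.

Section SubstitutionPowers.
Variable n : nat.
Implicit Types (s t : subst n) (x y : nat -> 'I_n).

Lemma subst_seq_pow t p x : nonerasing t ->
  subst_seq (pow_subst t p) x = iter p (subst_seq t) x.
Proof.
move=> tne; elim: p => [|p IH].
  apply: functional_extensionality => i; rewrite subst_seqE subst_word_pow.
  by rewrite nth_mkseq.
rewrite iterS -IH; apply: functional_extensionality => i.
rewrite subst_seqE subst_word_pow iterS -subst_word_pow.
apply: pref_nth; first exact/pref_subst/pref_subst/pref_mkseq/nonerasing_pow.
apply: leq_trans (size_subst_word1 _ tne).
apply: leq_trans (size_subst_word1 _ (nonerasing_pow p tne)).
by rewrite size_mkseq.
Qed.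

End SubstitutionPowers.

(** * Languages, subshifts and compactness *)

Section Language.
Variables (n : nat) (t : subst n).
Hypothesis tne : nonerasing t.
Implicit Types (x y u : nat -> 'I_n) (w v : seq 'I_n).

Lemma X_sub_shift x : X_sub t x -> X_sub t (shift x).
Proof.
move=> [u [gu cx]]; exists u; split=> // m; have [j jx] := cx m.+1.
exists j.+1 => i lti; rewrite /shift -(jx i.+1) //.
by rewrite /shiftn addSnnS.
Qed.

Lemma X_sub_gen u : gen_fixed_point t u -> X_sub t u.
Proof.
by move=> gu; exists u; split=> // m; exists 0 => i _; rewrite /shiftn addn0.
Qed.

Lemma gen_fixed_point_fixed u : fixed_point t u -> 1 < size (t (u 0)) ->
  gen_fixed_point t u.
Proof.
by move=> fu sz; exists 1; rewrite pow_subst1.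
Qed.

Lemma lang_infix w v : lang t w -> infix v w -> lang t v.
Proof. by move=> [m [a wa]] vw; exists m, a; apply: infix_trans wa. Qed.

Lemma lang_subst w : lang t w -> lang t (subst_word t w).
Proof.
move=> [m [a /infixP[l [r E]]]]; exists m.+1, a.
by rewrite pow_substS E !subst_word_cat infix_infix.
Qed.

Lemma X_sub_lang x m : X_sub t x -> lang t (mkseq x m).
Proof.
move=> [u [[p [_ [fu sz]]] cx]]; have [j /agree_mkseq <-] := cx m.
(* The (j+m)-th iterate of t^p on [u 0] is a prefix of [u] longer than j+m, so it covers the window
   of length m at j. *)
exists ((j + m) * p), (u 0); rewrite -pow_substM.
have sne := nonerasing_pow p tne.
have := pref_pow sne (j + m) fu erefl; rewrite /pref => <-.
have lt := size_iter_head sne (j + m) (fixed_head sne fu (u 0)) sz.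
by rewrite -(subnKC (ltnW lt)) -addnA mkseqD mkseqD infix_infix.
Qed.

Hypothesis tprim : primitive t.
Variable u : nat -> 'I_n.
Hypothesis (fu : fixed_point t u) (szu : 1 < size (t (u 0))).

(** If w lies in t^m(a), primitivity puts a in t^M(u_0), hence w in t^(m+M)(u_0), which is a prefix
    of [u]. *)
Lemma lang_occurs w : lang t w -> exists j, mkseq (shiftn j u) (size w) = w.
Proof.
move=> [m [a wa]]; have [M [_ tM]] := tprim.
have : infix w (pow_subst t (m + M) (u 0)).
  apply: infix_trans wa _; rewrite pow_substD.
  have /path.splitPr[l r] := tM (u 0) a.
  by rewrite subst_word_cat subst_word_cons infix_infix.
move=> /infixP[l [r E]]; exists (size l).
have := pref_pow tne (m + M) fu erefl; rewrite E catA => /pref_catl.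
rewrite /pref size_cat mkseqD => /(congr1 (drop (size l))).
by rewrite !drop_size_cat ?size_mkseq.
Qed.

(** Reduces membership to finite words, without reference to a generating fixed point; closedness
    and invariance under [t] follow from it. *)
Lemma X_subP x : X_sub t x <-> forall m, lang t (mkseq x m).
Proof.
split=> [Xx m | lx]; first exact: X_sub_lang.
exists u; split; first exact: gen_fixed_point_fixed.
move=> m; have [j jE] := lang_occurs (lx m); exists j.
by apply/agree_mkseq; rewrite -jE size_mkseq.
Qed.

Lemma X_sub_subst x : X_sub t x -> X_sub t (subst_seq t x).
Proof.
move=> /X_subP lx; apply/X_subP => m.
apply: lang_infix (lang_subst (lx m)) _.
rewrite -(pref_subst tne (pref_mkseq x m)).
have le : m <= size (subst_word t (mkseq x m)).
  by rewrite -[leqLHS](size_mkseq x) size_subst_word1.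
by rewrite -(subnKC le) mkseqD prefix_infix.
Qed.

Lemma X_sub_shiftn x j : X_sub t x -> X_sub t (shiftn j x).
Proof.
move=> Xx; elim: j => [|j IH].
  have -> // : shiftn 0 x = x.
  by apply: functional_extensionality => i; rewrite /shiftn addn0.
have -> : shiftn j.+1 x = shift (shiftn j x); last exact: X_sub_shift.
by apply: functional_extensionality => i; rewrite /shiftn /shift addnS.
Qed.

Lemma X_sub_closed x : (forall m, exists2 y, X_sub t y & agree m y x) ->
  X_sub t x.
Proof.
move=> cx; apply/X_subP => m; have [y Xy /agree_mkseq <-] := cx m.
exact: X_sub_lang.
Qed.

Lemma X_sub_word w : lang t w -> exists2 y, X_sub t y & pref w y.
Proof.
move=> /lang_occurs[j jE]; exists (shiftn j u) => //.
exact/X_sub_shiftn/X_sub_gen/gen_fixed_point_fixed.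
Qed.

End Language.

Section Compactness.
Variables (T : finType) (z : nat -> nat -> T).

Let frequent (w : seq T) := forall M, exists j, M <= j /\ pref w (z j).

(** Pigeonhole: if every one-letter extension of [w] stopped occurring, all would have stopped past
    the largest of finitely many bounds, yet [w] still occurs there, followed by some letter. *)
Let frequent_rcons w : frequent w -> exists a, frequent (rcons w a).
Proof.
move=> fw; apply: NNPP => nex.
have bnd a : exists M, forall j, M <= j -> ~ pref (rcons w a) (z j).
  apply: NNPP => nb; apply: nex; exists a => M; apply: NNPP => nM.
  by apply: nb; exists M => j Mj wj; apply: nM; exists j.
have [B hB] := choice _ bnd.
have [j [Bj wj]] := fw (\max_a B a).
apply: (hB (z j (size w)) j).
  exact: leq_trans (leq_bigmax _) Bj.
by rewrite /pref size_rcons mkseqS wj.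
Qed.

(** Koenig's argument: a frequent prefix is extended letter by letter, which yields a cluster point
    of [z]. *)
Lemma compact_seq : exists x, forall m M, exists j, M <= j /\ agree m (z j) x.
Proof.
have step w : exists a, frequent w -> frequent (rcons w a).
  case: (classic (frequent w)) => [/frequent_rcons[a fa]|nf]; first by exists a.
  by exists (z 0 0).
have [g hg] := choice _ step.
pose W := fix W m := if m is m'.+1 then rcons (W m') (g (W m')) else [::].
have szW m : size (W m) = m by elim: m => //= m IH; rewrite size_rcons IH.
have fW m : frequent (W m).
  by elim: m => [M|m IH]; [exists M | apply: hg].
pose x i := g (W i).
have Wx m : mkseq x m = W m.
  by elim: m => // m IH; rewrite mkseqS IH.
exists x => m M; have [j [Mj wj]] := fW m M; exists j; split=> //.
by apply/agree_mkseq; rewrite Wx -wj szW.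
Qed.

End Compactness.

Lemma branch_point_conj (S T : Type) (X : (nat -> S) -> Prop)
    (Y : (nat -> T) -> Prop) phi psi x k :
  (forall x, X x -> Y (phi x)) -> (forall y, Y y -> X (psi y)) ->
  (forall x, X x -> psi (phi x) = x) -> (forall y, Y y -> phi (psi y) = y) ->
  (forall x, X x -> X (shift x)) ->
  (forall x, X x -> phi (shift x) = shift (phi x)) ->
  branch_point X x k -> branch_point Y (phi x) k.
Proof.
move=> XY YX K1 K2 Xs E [k2 Xx [f [finj fP]]]; split=> //; first exact: XY.
have Xf j : X (f j) by have [] := (fP (f j)).2 (ex_intro _ j erefl).
exists (fun j => phi (f j)); split=> [i j ij | y].
  by apply: finj; rewrite -(K1 _ (Xf i)) ij K1.
split=> [[Yy sy] | [j <-]].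
  have [|j jE] := (fP (psi y)).1; last by exists j; rewrite jE K2.
  split; first exact: YX.
  have Xp := YX _ Yy; rewrite -(K1 _ (Xs _ Xp)) E // K2 // sy K1 //.
split; first exact/XY.
by rewrite -E //; have [_ ->] := (fP (f j)).2 (ex_intro _ j erefl).
Qed.

(** * Unique desubstitution *)

Definition desubst_spec n (t : subst n) (x : nat -> 'I_n)
    (d : nat * (nat -> 'I_n)) : Prop :=
  [/\ X_sub t d.2, d.1 < size (t (d.2 0)), x = shiftn d.1 (subst_seq t d.2) &
      forall k y, X_sub t y -> k < size (t (y 0)) ->
        x = shiftn k (subst_seq t y) -> d = (k, y)].

Definition desubstitution n (t : subst n) D : Prop :=
  forall x, X_sub t x -> desubst_spec t x (D x).

Lemma desubstitution_exists n (t : subst n) :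
  unil_recognizable t -> exists D, desubstitution t D.
Proof.
move=> trec; apply: (choice (fun x d => X_sub t x -> desubst_spec t x d)) => x.
(* Choice needs a total relation, so points outside [X_sub t] get an arbitrary value. *)
case: (classic (X_sub t x)) => [Xx|nX]; last by exists (0, x).
by have [kp [Xy lt E U]] := trec x Xx; exists kp; split=> // k y Xy' lt' /U ->.
Qed.

(** * The two-block substitution *)

Section BlockCode.
Variables (n N : nat) (t : subst n).
Variables (c : 'I_n -> 'I_n -> 'I_N) (l r : 'I_N -> 'I_n).

Definition block_code (x : nat -> 'I_n) : nat -> 'I_N :=
  fun i => c (x i) (x i.+1).

Definition block_proj (z : nat -> 'I_N) : nat -> 'I_n := fun i => l (z i).

(** [c] will number the two-letter words and [l], [r] read off their letters. As [t (l j)] will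
    begin with [l j], the [pairmap] runs over the consecutive pairs of the word [t (l j)] followed
    by [r j]. *)
Definition block_subst : subst N :=
  fun j => pairmap c (l j) (rcons (behead (t (l j))) (r j)).

(** Exactly what decoding a two-block coding requires; it can be checked before membership in
    [X_sub t] is known. *)
Definition admissible (x : nat -> 'I_n) : Prop :=
  forall i, lang t [:: x i; x i.+1].

Definition coherent (z : nat -> 'I_N) : Prop :=
  forall i, r (z i) = l (z i.+1).

Lemma agree_block_code m x y :
  agree m.+1 x y -> agree m (block_code x) (block_code y).
Proof. by move=> xy i lti; rewrite /block_code !xy // ltnW. Qed.

Lemma agree_block_proj m z z' :
  agree m z z' -> agree m (block_proj z) (block_proj z').
Proof. by move=> zz i lti; rewrite /block_proj zz. Qed.

Hypothesis t2 : forall a, 1 < size (t a).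
Hypothesis hd : forall a d, head d (t a) = a.
Hypothesis c_l : forall a b, lang t [:: a; b] -> l (c a b) = a.
Hypothesis c_r : forall a b, lang t [:: a; b] -> r (c a b) = b.
Hypothesis c_lr : forall j, c (l j) (r j) = j.
Hypothesis lang_lr : forall j, lang t [:: l j; r j].

Let tne : nonerasing t.
Proof. by apply/nonerasing_size => a; apply: ltnW. Qed.

Lemma size_block_subst j : size (block_subst j) = size (t (l j)).
Proof. by rewrite size_pairmap size_rcons size_behead prednK // ltnW. Qed.

Lemma block_subst_gt1 j : 1 < size (block_subst j).
Proof. by rewrite size_block_subst. Qed.

Let bne : nonerasing block_subst.
Proof. by apply/nonerasing_size => a; apply/ltnW/block_subst_gt1. Qed.

Lemma pref_rcons_subst y : pref (rcons (t (y 0)) (y 1)) (subst_seq t y).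
Proof.
have := pref_subst tne (pref_mkseq y 2).
rewrite /= !subst_word_cons -cats1; have := hd (y 1) (y 1).
case: (t (y 1)) (t2 (y 1)) => //= b s _ ->.
by rewrite -cat1s !catA => /pref_catl /pref_catl.
Qed.

(** The last pair of the first block uses the letter after that block, which is [y 1] because
    [t (y 1)] begins with it. The commutation of coding with substitution reduces to this one
    block. *)
Lemma nth_block_subst y i d : lang t [:: y 0; y 1] -> i < size (t (y 0)) ->
  nth d (block_subst (c (y 0) (y 1))) i = block_code (subst_seq t y) i.
Proof.
move=> ly lti; have py := pref_rcons_subst y.
have E : y 0 :: rcons (behead (t (y 0))) (y 1) = rcons (t (y 0)) (y 1).
  rewrite -rcons_cons; congr rcons; have := hd (y 0) (y 0).
  by case: (t (y 0)) (t2 (y 0)) => //= b s _ ->.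
rewrite /block_subst c_l // c_r // (nth_pairmap (y 0)); last first.
  by rewrite size_rcons size_behead prednK // ltnW.
have nthE k : k <= size (t (y 0)) ->
    nth (y 0) (y 0 :: rcons (behead (t (y 0))) (y 1)) k = subst_seq t y k.
  by move=> lek; rewrite E; apply: pref_nth => //; rewrite size_rcons ltnS.
by congr c; [apply/nthE/ltnW | apply: (nthE i.+1)].
Qed.

Lemma lang_pref2 w x i : lang t w -> pref w x -> i.+1 < size w ->
  lang t [:: x i; x i.+1].
Proof.
move=> lw wx lti; apply: lang_infix lw _; rewrite -wx.
rewrite -(subnKC lti) -addn2 -addnA mkseqD mkseqD.
exact: infix_infix.
Qed.

Lemma admissible_subst x : admissible x -> admissible (subst_seq t x).
Proof.
move=> ax i; have [m [j [ltj ->]]] := subst_seq_pos tne x i.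
rewrite -[_ (j + _)]/(shiftn _ _ j) -[_ (j + _).+1]/(shiftn _ _ j.+1).
rewrite shiftn_subst_seq //.
(* Positions j and j+1 both lie in the image of x_m x_(m+1), since j is inside its first block. *)
apply: (lang_pref2 (lang_subst (ax m))).
  by apply: pref_subst => //; rewrite /pref /= /mkseq /= /shiftn.
rewrite 2!subst_word_cons !size_cat -[j.+2]addn1 leq_add //.
exact: leq_trans (ltnW (t2 _)) (leq_addr _ _).
Qed.

Lemma block_codeK x : admissible x -> block_proj (block_code x) = x.
Proof.
by move=> ax; apply: functional_extensionality => i; apply/c_l/ax.
Qed.

Lemma coherent_admissible z : coherent z -> admissible (block_proj z).
Proof. by move=> cz i; rewrite /block_proj -cz; apply: lang_lr. Qed.

Lemma block_projK z : coherent z -> block_code (block_proj z) = z.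
Proof.
move=> cz; apply: functional_extensionality => i.
by rewrite /block_code /block_proj -cz c_lr.
Qed.

Lemma block_code_subst x : admissible x ->
  subst_seq block_subst (block_code x) = block_code (subst_seq t x).
Proof.
move=> ax; apply: functional_extensionality => i.
have [m [j [ltj ->]]] := subst_seq_pos tne x i.
(* Since |tau'(ab)| = |t(a)|, blocks begin at the same positions in both sequences. *)
have szP : size (subst_word block_subst (mkseq (block_code x) m)) =
          size (subst_word t (mkseq x m)).
  elim: m {ltj} => // m IH; rewrite !mkseqS -!cats1 !subst_word_cat !size_cat.
  by rewrite IH size_block_subst c_l.
transitivity (subst_seq block_subst (shiftn m (block_code x)) j).
  by rewrite -shiftn_subst_seq // szP.
transitivity (block_code (subst_seq t (shiftn m x)) j); last first.
  by rewrite -shiftn_subst_seq.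
have lty : lang t [:: shiftn m x 0; shiftn m x 1] by apply: ax.
rewrite -(nth_block_subst (block_code x 0) lty ltj).
rewrite (@subst_seq_nth _ _ bne _ 1 _ (block_code x 0)) /= subst_word1 //.
by rewrite size_block_subst c_l.
Qed.

Lemma iter_block_code_subst x q : admissible x ->
  iter q (subst_seq block_subst) (block_code x) =
  block_code (iter q (subst_seq t) x).
Proof.
elim: q x => // q IH x ax.
by rewrite !iterSr block_code_subst // IH //; apply: admissible_subst.
Qed.

Lemma admissible_X x : X_sub t x -> admissible x.
Proof. by move=> Xx i; have := X_sub_lang tne 2 (X_sub_shiftn i Xx). Qed.

Lemma fixed_block_code v p : admissible v ->
  fixed_point (pow_subst t p) v <->
  fixed_point (pow_subst block_subst p) (block_code v).
Proof.
move=> av; rewrite /fixed_point !subst_seq_pow //.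
rewrite iter_block_code_subst //; split=> [-> // | /(congr1 block_proj)].
(* Decoding the iterate requires its admissibility, which is inherited at each substitution. *)
rewrite !block_codeK //; elim: p {av} v (av) => // p IH v av.
rewrite iterSr; apply/IH/admissible_subst/av.
Qed.

Variable u : nat -> 'I_n.
Hypothesis (tprim : primitive t) (fu : fixed_point t u).

Lemma word_start a b : lang t [:: a; b] ->
  exists y, [/\ X_sub t y, y 0 = a & y 1 = b].
Proof.
move=> /(X_sub_word tne tprim fu (t2 _))[y Xy]; rewrite /pref /mkseq /=.
by case=> ya yb; exists y.
Qed.

(* If z_0 = ab, extend ab to a point y of X_t: the iterates of z_0 are prefixes
   of both z and the codings of the iterates of y. *)
Lemma gen_fixed_coherent z : gen_fixed_point block_subst z -> coherent z.
Proof.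
move=> [p [p0 [fz sz]]] i.
have [y [Xy ya yb]] := word_start (lang_lr (z 0)).
have sne := nonerasing_pow p bne.
have := pref_pow sne i.+2 fz erefl; rewrite pow_substM; set q := _ * p => wz.
have ltw : i.+2 < size (pow_subst block_subst q (z 0)).
  by rewrite -pow_substM; apply: size_iter_head (fixed_head sne fz (z 0)) sz.
have : pref (pow_subst block_subst q (z 0))
            (subst_seq (pow_subst block_subst q) (block_code y)).
  rewrite -[pow_subst _ q (z 0)]subst_word1; apply: pref_subst.
    exact: nonerasing_pow.
  by rewrite /pref /mkseq /= /block_code ya yb c_lr.
rewrite subst_seq_pow // iter_block_code_subst; last exact: admissible_X.
have Xq : X_sub t (iter q (subst_seq t) y).
  by elim: (q) => // q' IH; apply: (X_sub_subst tne tprim fu (t2 _)).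
move: (iter q _ y) Xq => y' /admissible_X ay wy.
have zy := agree_pref wz wy.
rewrite (zy i (ltnW (ltnW ltw))) (zy i.+1 (ltnW ltw)).
by rewrite /block_code c_l // c_r.
Qed.

Lemma X_block_code x : X_sub t x -> X_sub block_subst (block_code x).
Proof.
move=> [v [gv cx]]; exists (block_code v); split; last first.
  by move=> m; have [j jx] := cx m.+1; exists j; apply: agree_block_code.
have av := admissible_X (X_sub_gen gv); case: gv => p [p0 [fv _]].
exists p; split=> //; split; first exact/fixed_block_code.
exact/(leq_ltn_trans p0)/size_pow_subst/block_subst_gt1.
Qed.

(** Coherence at [i] involves two neighbouring letters only, so it passes from a generating fixed
    point to its orbit closure. *)
Lemma X_block_coherent z : X_sub block_subst z -> coherent z.
Proof.
move=> [v [gv cz]] i; have [j jz] := cz i.+2.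
rewrite -(jz i (ltnW (ltnSn _))) -(jz i.+1 (ltnSn _)).
exact: gen_fixed_coherent gv (i + j).
Qed.

Lemma X_block_proj z : X_sub block_subst z -> X_sub t (block_proj z).
Proof.
move=> [v [gv cz]]; exists (block_proj v); split; last first.
  by move=> m; have [j jz] := cz m; exists j; apply: agree_block_proj.
have cv := gen_fixed_coherent gv; case: gv => p [p0 [fv _]].
exists p; split=> //; split.
  by apply/(fixed_block_code p (coherent_admissible cv)); rewrite block_projK.
exact/(leq_ltn_trans p0)/size_pow_subst.
Qed.

Lemma conj_block_code :
  top_conj (X_sub t) (@shift _) (X_sub block_subst) (@shift _).
Proof.
exists block_code, block_proj; split; first exact: X_block_code.
split; first exact: X_block_proj.
split; first by move=> x /admissible_X; apply: block_codeK.
split; first by move=> z /X_block_coherent; apply: block_projK.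
split; first by move=> x _ m; exists m.+1 => y _; apply: agree_block_code.
by split=> // z _ m; exists m => y _; apply: agree_block_proj.
Qed.

Lemma suffix_permutative_block :
  suffix_permutative t -> suffix_permutative block_subst.
Proof.
move=> [f [/bij_inj finj lastf]].
have lst a d : last d (t a) = f a.
  by rewrite -(lastf a); case: (t a) (t2 a).
(* The word f(a)b belongs to the language because it straddles the first two blocks of t(y), for a
   point y starting with ab. *)
have step j : [/\ lang t [:: f (l j); r j] &
    last (c (f (l j)) (r j)) (block_subst j) = c (f (l j)) (r j)].
  have [y [Xy yl yr]] := word_start (lang_lr j).
  have sz : (size (t (y 0))).-1 < size (t (y 0)).
    by rewrite prednK // ltnW.
  have py := pref_rcons_subst y.
  have y_last : subst_seq t y (size (t (y 0))).-1 = f (l j).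
    rewrite -(pref_nth (y 0) py); last by rewrite size_rcons ltnS leq_pred.
    by rewrite nth_rcons sz nth_last lst yl.
  have y_next : subst_seq t y (size (t (y 0))).-1.+1 = r j.
    rewrite (prednK (ltnW (t2 _))) -(pref_nth (y 0) py) ?size_rcons //.
    by rewrite nth_rcons ltnn eqxx.
  split.
    rewrite -y_last -y_next.
    exact/admissible_X/(X_sub_subst tne tprim fu (t2 _)).
  have jE : j = c (y 0) (y 1) by rewrite yl yr c_lr.
  rewrite -nth_last size_block_subst -yl; set d := c _ (r j); rewrite jE.
  rewrite nth_block_subst //; last by apply: admissible_X.
  by rewrite /block_code y_last y_next /d yl.
exists (fun j => c (f (l j)) (r j)); split; last by move=> j; case: (step j).
apply: injF_bij => i j.
have [[li _] [lj _]] := (step i, step j) => E.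
have /finj El : f (l i) = f (l j) by rewrite -(c_l li) E c_l.
have Er : r i = r j by rewrite -(c_r li) E c_r.
by rewrite -[i]c_lr El Er c_lr.
Qed.

Lemma fixed_points_branch_block q (k : 'I_q -> nat) :
  fixed_points_branch t k -> fixed_points_branch block_subst k.
Proof.
move=> [v [vinj vP vbr]].
have Xv i : X_sub t (v i) by have [] := vbr i.
have fixP x : admissible x ->
    fixed_point t x <-> fixed_point block_subst (block_code x).
  by move=> ax; have := fixed_block_code 1 ax; rewrite !pow_subst1.
exists (fun i => block_code (v i)); split.
- move=> i j /(congr1 block_proj); rewrite !block_codeK; first exact: vinj.
    exact/admissible_X/Xv.
  exact/admissible_X/Xv.
- move=> z; split=> [fz | [i <-]]; last first.
    by apply/fixP; [apply/admissible_X/Xv | apply/vP; exists i].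
  (* Blocks of length at least 2 make every fixed point generating, hence coherent and decodable. *)
  have cz := gen_fixed_coherent (gen_fixed_point_fixed fz (block_subst_gt1 _)).
  have /vP[i vi] : fixed_point t (block_proj z).
    by apply/fixP; [apply: coherent_admissible | rewrite block_projK].
  by exists i; rewrite vi block_projK.
- move=> i; apply: (branch_point_conj (psi := block_proj) _ _ _ _ _ _ (vbr i)).
  + exact: X_block_code.
  + exact: X_block_proj.
  + by move=> x /admissible_X; apply: block_codeK.
  + by move=> z /X_block_coherent; apply: block_projK.
  + exact: X_sub_shift.
  + by [].
Qed.

(** * Bratteli paths of points *)

Section Desubstitution.
Variable D : (nat -> 'I_n) -> nat * (nat -> 'I_n).
Hypothesis hD : desubstitution t D.

(** Otherwise points [w j] tending to [x] have desubstitutions that stay away from that of [x]. A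
    cluster point of these desubstitutes [x] as well, so uniqueness identifies it with [D x], a
    contradiction. *)
Lemma desubst_cont x m : X_sub t x -> exists k, forall x',
  X_sub t x' -> agree k x x' ->
  (D x').1 = (D x).1 /\ agree m (D x).2 (D x').2.
Proof.
move=> Xx; apply: NNPP => nk.
have bad k : exists x', [/\ X_sub t x', agree k x x' &
    ~ ((D x').1 = (D x).1 /\ agree m (D x).2 (D x').2)].
  apply: NNPP => nx; apply: nk; exists k => x' Xx' xx'.
  by apply: NNPP => nD; apply: nx; exists x'.
have [w hw] := choice _ bad.
pose S := \max_(a : 'I_n) size (t a).
have D1 j : (D (w j)).1 < S.+1.
  have [/hD[_ lt _ _] _ _] := hw j.
  exact/ltnW/(leq_trans lt)/(leq_bigmax (F := fun a => size (t a))).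
(* The bounded offset is repeated in every coordinate, so that compactness over one finite alphabet
   gives its limit together with that of the points. *)
pose z j i : 'I_n * 'I_S.+1 := ((D (w j)).2 i, inord (D (w j)).1).
have [zl hz] := compact_seq z.
pose y i := (zl i).1; pose k : nat := (zl 0).2.
have lim q M : exists j, [/\ M <= j, agree q (D (w j)).2 y & (D (w j)).1 = k].
  have [j [Mj aj]] := hz q.+1 M; exists j; split=> //.
    by move=> i lti; rewrite /y -aj // ltnW.
  by rewrite /k -aj //= inordK.
have Xy : X_sub t y.
  apply: (X_sub_closed tne tprim fu (t2 _)) => q.
  have [j [_ aj _]] := lim q 0; exists (D (w j)).2 => //.
  by have [/hD[]] := hw j.
have xE : x = shiftn k (subst_seq t y).
  apply: functional_extensionality => i.
  have [j [ij aj kj]] := lim (i + k).+1 i.+1.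
  have [/hD[_ _ E _] xj _] := hw j.
  by rewrite (xj i) // E /shiftn kj; apply: agree_subst aj _ _.
have ltk : k < size (t (y 0)).
  have [j [_ aj <-]] := lim 1 0; rewrite -(aj 0) //.
  by have [/hD[]] := hw j.
have [j [_ aj kj]] := lim m 0; have [_ _] := hw j; apply.
have [_ _ _ uD] := hD Xx; rewrite (uD _ _ Xy ltk xE) kj; split=> //.
exact: agree_sym.
Qed.

Definition desubst_iter (x : nat -> 'I_n) (i : nat) : nat -> 'I_n :=
  iter i (fun z => (D z).2) x.

(** The edge of index i+1 records the offset of x_i in tau(x_(i+1)); the unique edge from the root
    has position 0. *)
Definition path_of (x : nat -> 'I_n) : nat -> 'I_N * nat := fun i =>
  (block_code (desubst_iter x i) 0,
   if i is i'.+1 then (D (desubst_iter x i')).1 else 0).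

Lemma desubst_iterS x i : desubst_iter x i.+1 = (D (desubst_iter x i)).2.
Proof. by []. Qed.

Lemma path_ofS x i : path_of x i.+1 =
  (block_code (D (desubst_iter x i)).2 0, (D (desubst_iter x i)).1).
Proof. by []. Qed.

Lemma X_desubst_iter x i : X_sub t x -> X_sub t (desubst_iter x i).
Proof. by move=> Xx; elim: i => // i /hD[]. Qed.

Lemma path_of_vertexS x i : (path_of x i.+1).1 = (path_of (D x).2 i).1.
Proof. by rewrite /path_of /desubst_iter iterSr. Qed.

(** Desubstituting once deletes the bottom level of the path. Index 1 is left out because its
    position is reset to 0 when it becomes the root edge. *)
Lemma path_ofSS x i : path_of x i.+2 = path_of (D x).2 i.+1.
Proof. by rewrite /path_of /desubst_iter !iterSr. Qed.

Lemma size_path_of x i : X_sub t x ->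
  size (block_subst (path_of x i).1) = size (t (desubst_iter x i 0)).
Proof.
by move=> Xx; rewrite size_block_subst c_l //; apply/admissible_X/X_desubst_iter.
Qed.

Lemma path_of_B x : X_sub t x -> B_path block_subst (path_of x).
Proof.
move=> Xx; split=> // -[//|i] _; rewrite size_path_of //=.
have [Xy lt zE _] := hD (X_desubst_iter i Xx); split=> //.
rewrite nth_block_subst //; last by apply: admissible_X.
exact: (esym (congr1 (fun g => block_code g 0) zE)).
Qed.

(* The letters of x_1 after the first contribute at least two letters each to x,
   so every further level of agreement gains at least one letter. *)
Lemma agree_path_of m x x' : X_sub t x -> X_sub t x' ->
  agree m.+1 (path_of x) (path_of x') -> agree m.+2 x x'.
Proof.
elim: m x x' => [|m IH] x x' Xx Xx' xx'.
  have [E] : path_of x 0 = path_of x' 0 by apply: xx'.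
  have [ax ax'] := (admissible_X Xx 0, admissible_X Xx' 0).
  case=> [|[|//]] _; first by move: (congr1 l E); rewrite /block_code !c_l.
  by move: (congr1 r E); rewrite /block_code !c_r.
have [[Xy lt E _] [Xy' lt' E' _]] := (hD Xx, hD Xx').
have kk : (D x).1 = (D x').1 by have /(congr1 snd) := xx' 1 isT.
have yy : agree m.+2 (D x).2 (D x').2.
  apply: IH => // -[_|i lti]; last by rewrite -!path_ofSS xx'.
  by apply/(congr1 (fun a => (a, 0)))/(congr1 fst (xx' 1 isT)).
move: E E' yy lt; rewrite -kk.
move: (D x).1 (D x).2 (D x').2 => k y y' -> -> yy lt.
have := agree_pref (pref_subst tne (pref_mkseq y m.+2)).
move/(_ (subst_seq t y')); rewrite {1}(proj1 (agree_mkseq _ _ _) yy).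
move/(_ (pref_subst tne (pref_mkseq _ _))) => a i lti; rewrite /shiftn; apply: a.
(* With k < |t(y_0)| and i <= m+2, the position i+k is below |t(y_0)| + 2(m+1), and each of the m+1
   letters after y_0 contributes at least two letters. *)
rewrite -[m.+2]add1n mkseqD subst_word_cat size_cat subst_word1.
have sz := size_subst_word (mkseq (shiftn 1 y) m.+1) t2.
rewrite addnC -addSn leq_add // (leq_trans _ sz) // size_mkseq mul2n -addnn.
by rewrite (leq_trans (lti : i <= m.+2)) // addnS addSn !ltnS leq_addr.
Qed.

Lemma path_of_cont x m : X_sub t x -> exists k, forall x',
  X_sub t x' -> agree k x x' -> agree m (path_of x) (path_of x').
Proof.
elim: m x => [|m IH] x Xx; first by exists 0.
have [Xy _ _ _] := hD Xx; have [k1 hk1] := IH _ Xy.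
(* Two letters of [x] fix the bottom vertex; [k] controls the first offset and the levels above. *)
have [k hk] := desubst_cont k1 Xx; exists (maxn 2 k) => x' Xx' xx'.
have [Xy' _ _ _] := hD Xx'.
have [kk yy] := hk x' Xx' (agreeW (leq_maxr _ _) xx').
have {hk1}pp := hk1 _ Xy' yy.
case=> [_|i lti].
  have e := agreeW (leq_maxl 2 k) xx'.
  by rewrite /path_of /block_code /= (e 0) // (e 1).
apply: injective_projections; first by rewrite !path_of_vertexS pp.
by case: i lti => [|i] lti; [rewrite /= kk | rewrite !path_ofSS pp].
Qed.

(** Induction on the number of levels: realize the path without its bottom level by [y], then
    substitute [y] and shift by the position of the first edge. Uniqueness of desubstitution
    recovers [y] from the result. *)
Lemma path_of_prefix p m : B_path block_subst p ->
  exists2 x, X_sub t x & agree m.+1 (path_of x) p.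
Proof.
elim: m p => [|m IH] p [p0 Bp].
  have [y [Xy yl yr]] := word_start (lang_lr (p 0).1); exists y => // -[|//] _.
  by rewrite /path_of /block_code /= yl yr c_lr; case: (p 0) p0 => a b /= ->.
pose p' i := ((p i.+1).1, if i is 0 then 0 else (p i.+1).2).
have Bp' : B_path block_subst p'.
  split=> // -[//|i] _; have [lt E] := Bp i.+2 isT.
  by split.
have [y Xy yp] := IH p' Bp'.
have v1 : (p 1).1 = block_code y 0 := esym (congr1 fst (yp 0 isT)).
have ly := admissible_X Xy 0.
have [lt1 E1] := Bp 1 isT; rewrite v1 in lt1 E1.
rewrite size_block_subst c_l // in lt1.
rewrite nth_block_subst // in E1.
pose x := shiftn (p 1).2 (subst_seq t y).
have Xx : X_sub t x.
  exact/X_sub_shiftn/(X_sub_subst tne tprim fu (t2 _)).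
have Dx : D x = ((p 1).2, y) by have [_ _ _] := hD Xx; apply.
exists x => // -[_|i lti].
  by move: p0 E1 => /=; case: (p 0) => a b /= -> <-.
apply: injective_projections; first by rewrite path_of_vertexS Dx yp.
by case: i lti => [|i] lti; [rewrite /= Dx | rewrite path_ofSS Dx yp].
Qed.

Lemma path_of_surj p : B_path block_subst p ->
  exists2 x, X_sub t x & path_of x = p.
Proof.
move=> Bp.
have ap m : exists x, X_sub t x /\ agree m.+1 (path_of x) p.
  by have [x Xx xp] := path_of_prefix m Bp; exists x.
have [w hw] := choice _ ap; have [x wx] := compact_seq w.
have Xx : X_sub t x.
  apply: (X_sub_closed tne tprim fu (t2 _)) => m.
  by have [j [_ aj]] := wx m 0; exists (w j) => //; have [] := hw j.
exists x => //; apply: functional_extensionality => i.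
(* For [j] large, the path of [w j] agrees at level [i] with that of [x] by continuity, and with [p]
   by construction. *)
have [k hk] := path_of_cont i.+1 Xx; have [j [ij jx]] := wx k i.
have [Xw wp] := hw j.
by rewrite (hk _ Xw (agree_sym jx)) // wp.
Qed.

(** * The shift as the Vershik map on paths *)

Lemma desubst_shift_carry x : X_sub t x ->
  (D x).1.+1 = size (t ((D x).2 0)) -> D (shift x) = (0, shift (D x).2).
Proof.
move=> Xx sz; have [Xy _ E _] := hD Xx; have [_ _ _] := hD (X_sub_shift Xx).
apply; first exact: X_sub_shift.
  by rewrite ltnW.
rewrite subst_seq_shift // -sz {1}E; apply: functional_extensionality => i.
by rewrite /shift /shiftn addn0 addSnnS.
Qed.

Lemma desubst_shift_inc x : X_sub t x ->
  (D x).1.+1 < size (t ((D x).2 0)) -> D (shift x) = ((D x).1.+1, (D x).2).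
Proof.
move=> Xx sz; have [Xy _ E _] := hD Xx; have [_ _ _] := hD (X_sub_shift Xx).
apply=> //; rewrite {1}E; apply: functional_extensionality => i.
by rewrite /shift /shiftn addSnnS.
Qed.

(** Odometer carry: a maximal edge means that the shift leaves the current block, so it acts as a
    shift one level up, with offset 0. *)
Lemma desubst_iter_shift x k : X_sub t x ->
  (forall i, i < k.+1 -> edge_max block_subst (path_of x) i) ->
  forall i, i < k.+1 -> desubst_iter (shift x) i = shift (desubst_iter x i) /\
    (path_of (shift x) i).2 = 0.
Proof.
move=> Xx mx; elim=> // i IH lti; have [E _] := IH (ltnW lti).
have [//|] := mx _ lti; rewrite size_path_of //= => sz.
have Di := desubst_shift_carry (X_desubst_iter i Xx) sz.
by rewrite -/(desubst_iter _ i) E Di.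
Qed.

Lemma vershik_at_shift x : X_sub t x -> B_nonmax block_subst (path_of x) ->
  vershik_at block_subst (path_of x) (path_of (shift x)).
Proof.
move=> Xx nmx.
have [k [nmk mink]] : exists k, ~ edge_max block_subst (path_of x) k /\
    forall i, i < k -> edge_max block_subst (path_of x) i.
  case: nmx => i; elim/ltn_ind: i => i IH nmi.
  case: (classic (exists2 j, j < i & ~ edge_max block_subst (path_of x) j)).
    by move=> [j lt /IH]; apply.
  move=> nj; exists i; split=> // j lt; apply: NNPP => nmj.
  by apply: nj; exists j.
exists k; split=> //; case: k nmk mink => [|k] nmk mink; first by case: nmk; left.
have Xk := X_desubst_iter k Xx.
have sz : (D (desubst_iter x k)).1.+1 < size (t ((D (desubst_iter x k)).2 0)).
  have [_ lt _ _] := hD Xk; rewrite ltn_neqAle lt andbT.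
  by apply/eqP => E; apply: nmk; right; rewrite size_path_of.
have below := desubst_iter_shift Xx mink.
have Dk : D (desubst_iter (shift x) k) =
          ((D (desubst_iter x k)).1.+1, (D (desubst_iter x k)).2).
  by have [-> _] := below k (ltnSn k); apply: desubst_shift_inc.
(* At level k+1 only the offset changes, so both points have the same desubstitutions from there
   on. *)
have above i : desubst_iter (shift x) (k.+1 + i) = desubst_iter x (k.+1 + i).
  elim: i => [|i IH]; first by rewrite addn0 !desubst_iterS Dk.
  by rewrite addnS [LHS]desubst_iterS IH.
have [_ Bq] := path_of_B (X_sub_shift Xx).
have qk : path_of (shift x) k.+1 = ((path_of x k.+1).1, (path_of x k.+1).2.+1).
  by rewrite !path_ofS Dk.
move=> b; split=> // [i lti | i lti].
  by rewrite -(subnKC lti) addSn !path_ofS above.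
suff vE : (path_of (shift x) i).1 = min_vertex block_subst b (k.+1.-1 - i).
  by rewrite -vE -(proj2 (below i lti)); case: (path_of _ i).
(* Descending induction from level k, whose vertex is the source [b] of the incremented edge; each
   lower vertex is the first letter of the image of the one above, all positions there being 0. *)
rewrite succnK -[in LHS](subKn (lti : i <= k)).
elim: (k - i) (leq_subr i k) => [|d IH] led.
  by rewrite subn0; have [_] := Bq k.+1 isT; rewrite qk.
have e : k - d = (k - d.+1).+1 by rewrite subnS prednK // subn_gt0.
have ltk : k - d < k.+1 by rewrite ltnS leq_subr.
have [_] := Bq (k - d) (leq_trans (ltn0Sn _) (eq_leq (esym e))).
by rewrite (proj2 (below _ ltk)) (IH (ltnW led)) e => <-.
Qed.

Lemma vershik_conj : exists Vbar : (nat -> 'I_N * nat) -> (nat -> 'I_N * nat),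
  [/\ forall p, B_path block_subst p -> B_path block_subst (Vbar p),
      forall p, B_path block_subst p -> B_nonmax block_subst p ->
        vershik_at block_subst p (Vbar p),
      cont_on (B_path block_subst) Vbar &
      top_conj (X_sub block_subst) (@shift _) (B_path block_subst) Vbar].
Proof.
have sur p : exists x, B_path block_subst p -> X_sub t x /\ path_of x = p.
  case: (classic (B_path block_subst p)) => [/path_of_surj[x Xx xp]|nB].
    by exists x.
  by exists (block_proj (fun i => (p i).1)).
have [psi hpsi] := choice _ sur.
have Xpsi p : B_path block_subst p -> X_sub t (psi p) by case/hpsi.
have psiK p : B_path block_subst p -> path_of (psi p) = p by case/hpsi.
(* Agreement on m+1 levels gives agreement on m+2 letters, for every m; the same estimate makes the
   inverse continuous. *)
have path_inj x x' : X_sub t x -> X_sub t x' -> path_of x = path_of x' -> x = x'.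
  move=> Xx Xx' E; apply: functional_extensionality => i.
  by apply: (@agree_path_of i _ _ Xx Xx') => [j _|]; [rewrite E | apply: ltnW].
have pathK x : X_sub t x -> psi (path_of x) = x.
  move=> Xx; have Bx := path_of_B Xx.
  by apply: path_inj; [apply: Xpsi | | apply: psiK].
have psi_agree m p q : B_path block_subst p -> B_path block_subst q ->
    agree m.+1 p q -> agree m.+2 (psi p) (psi q).
  by move=> Bp Bq pq; apply: agree_path_of; rewrite ?psiK //; apply: Xpsi.
exists (fun p => path_of (shift (psi p))); split.
- by move=> p Bp; apply/path_of_B/X_sub_shift/Xpsi.
- move=> p Bp; rewrite -{1 2}(psiK p Bp); apply: vershik_at_shift.
  exact: Xpsi.
- move=> p Bp m; have [k hk] := path_of_cont m (X_sub_shift (Xpsi p Bp)).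
  exists k.+1 => q Bq pq; apply: hk; first exact/X_sub_shift/Xpsi.
  by apply: agreeW (agree_shift (psi_agree _ _ _ Bp Bq pq)).
exists (fun z => path_of (block_proj z)), (fun p => block_code (psi p)).
split; first by move=> z /X_block_proj /path_of_B.
split; first by move=> p /Xpsi /X_block_code.
split=> [z Xz|].
  by rewrite pathK; [apply/block_projK/X_block_coherent | apply: X_block_proj].
split=> [p Bp|]; first by rewrite block_codeK ?psiK //; apply/admissible_X/Xpsi.
split=> [z Xz m|].
  have [k hk] := path_of_cont m (X_block_proj Xz); exists k => z' Xz' zz.
  by apply: hk; [apply: X_block_proj | apply: agree_block_proj].
split=> [p Bp m|z Xz]; last by rewrite (pathK _ (X_block_proj Xz)).
exists m.+1 => q Bq /(psi_agree _ _ _ Bp Bq) pq.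
by apply: agree_block_code; apply: agreeW pq.
Qed.

End Desubstitution.

End BlockCode.

(** * Construction of the recoded substitution *)

(** If t(a) = a, then t^m(a) = a, so primitivity leaves a single letter and the subshift has at most
    one point. *)
Lemma fixed_head_size n (t : subst n) a d : nonerasing t -> primitive t ->
  infinite_subshift t -> head d (t a) = a -> 1 < size (t a).
Proof.
move=> tne [m [_ tm]] tinf ha; rewrite ltnNge; apply/negP => le1; apply: tinf.
have ta : t a = [:: a].
  by move: (tne a) ha le1; case: (t a) => [|b [|]] //= _ ->.
have tma : pow_subst t m a = [:: a].
  by elim: (m) => // m' IH; rewrite pow_substS IH subst_word1.
have alla b : b = a by have := tm a b; rewrite tma inE => /eqP.
exists [:: fun=> a]%list => x _; left.
by apply: functional_extensionality => i; rewrite (alla (x i)).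
Qed.

(** Fixed points are determined by their first letter, so n of them have n distinct first letters,
    which exhaust the alphabet. *)
Lemma head_fixed n (t : subst n) : nonerasing t -> primitive t ->
  infinite_subshift t ->
  (exists u : 'I_n -> nat -> 'I_n, injective u /\ forall i, fixed_point t (u i)) ->
  forall a, exists2 x, fixed_point t x & x 0 = a.
Proof.
move=> tne tprim tinf [u [uinj fu]] a.
have inj0 : injective (fun i => u i 0).
  move=> i j ij; apply: uinj; apply: (fixed_point_uniq tne) => //.
  exact: (fixed_head_size tne tprim tinf (fixed_head tne (fu i) (u i 0))).
have [g _ gK] := injF_bij inj0; exists (u (g a)) => //; exact: gK.
Qed.

Theorem theorem19 (n N : nat) (tau : subst n) (k : 'I_n -> nat) :
  nonerasing tau ->
  primitive tau -> infinite_subshift tau -> unil_recognizable tau ->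
  powers_injective tau ->
  prefix_permutative tau -> suffix_permutative tau ->
  fixed_points_branch tau k ->
  num_words2 tau N ->
  exists tau' : subst N,
    [/\ nonerasing tau', suffix_permutative tau',
        fixed_points_branch tau' k,
        top_conj (X_sub tau) (@shift _) (X_sub tau') (@shift _) &
        exists Vbar : (nat -> 'I_N * nat) -> (nat -> 'I_N * nat),
          [/\ forall p, B_path tau' p -> B_path tau' (Vbar p),
              forall p, B_path tau' p -> B_nonmax tau' p ->
                vershik_at tau' p (Vbar p),
              cont_on (B_path tau') Vbar &
              top_conj (X_sub tau') (@shift _) (B_path tau') Vbar]].
Proof.
move=> tne tprim tinf trec _ _ tsuf tbr [e [einj eP]].
(* A point of the nonempty subshift supplies the default letter [x0 0] and, through its first two
   letters, the default index [j0]. *)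
have [x0 Xx0] : exists x, X_sub tau x.
  apply: NNPP => nX; apply: tinf; exists nil => x Xx.
  by case: nX; exists x.
have allfix : forall a, exists2 x, fixed_point tau x & x 0 = a.
  apply: head_fixed => //; have [u [uinj uP _]] := tbr.
  by exists u; split=> // i; apply/uP; exists i.
have hd a d : head d (tau a) = a.
  by have [x fx <-] := allfix a; apply: fixed_head.
have t2 a : 1 < size (tau a) := fixed_head_size tne tprim tinf (hd a a).
have [u fu _] := allfix (x0 0).
have [j0 _] := (eP _).1 (conj (X_sub_lang tne 2 Xx0) (size_mkseq _ _)).
(* The default [j0] is reached only for words outside the language. *)
pose c a b := odflt j0 [pick j | e j == [:: a; b]].
pose l j := nth (x0 0) (e j) 0; pose r j := nth (x0 0) (e j) 1.
have eE j : lang tau (e j) /\ e j = [:: l j; r j].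
  have [le] := (eP (e j)).2 (ex_intro _ j erefl).
  by rewrite /l /r; case: (e j) le => [|a [|b []]].
have lang_lr j : lang tau [:: l j; r j] by have [] := eE j => + <-.
have cP a b : lang tau [:: a; b] -> e (c a b) = [:: a; b].
  move=> lab; rewrite /c; case: pickP => [j /eqP // | nj].
  by have [j jE] := (eP _).1 (conj lab erefl); have := nj j; rewrite jE eqxx.
have c_l a b : lang tau [:: a; b] -> l (c a b) = a by move=> /cP; rewrite /l => ->.
have c_r a b : lang tau [:: a; b] -> r (c a b) = b by move=> /cP; rewrite /r => ->.
have c_lr j : c (l j) (r j) = j.
  by apply: einj; rewrite cP //; have [] := eE j.
have [D hD] := desubstitution_exists trec.
exists (block_subst tau c l r); split.
- by apply/nonerasing_size => j; apply/ltnW/block_subst_gt1.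
- exact: (suffix_permutative_block t2 hd c_l c_r c_lr lang_lr tprim fu).
- exact: (fixed_points_branch_block t2 hd c_l c_r c_lr lang_lr tprim fu).
- exact: (conj_block_code t2 hd c_l c_r c_lr lang_lr tprim fu).
- exact: (vershik_conj t2 hd c_l c_r c_lr lang_lr tprim fu hD).
Qed.
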